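(* Let $A$ be a uniform algebra, let $\theta : A \to M_n(\mathbb{C})$ be a continuous unital homomorphism, and let $\alpha : A\to A$ be a unital antilinear contraction such that $\alpha(A) \subset \mathbb{C}1$. Define $$\theta_\alpha(f) := \tfrac12\bigl(\theta(f)+\theta(\alpha(f))^*\bigr)\quad (f \in A).$$ If $\|\theta_\alpha\| \le 1$, then $\|\theta\| \le 2$.
   Context: A uniform algebra is a norm-closed subalgebra of $C(X)$, for $X$ a compact Hausdorff space, containing the constants, with the supremum norm. $M_n(\mathbb{C})$ carries the operator norm. A map $\alpha$ is antilinear if $\alpha(\lambda f+g)=\overline\lambda\alpha(f)+\alpha(g)$. It is a contraction if $\|\alpha(f)\|\le \|f\|$, and it is unital if $\alpha(1)=1$. *)

(* Defs.v *)
From HB Require Import structures.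
From mathcomp Require Import all_boot all_order all_algebra.
From mathcomp Require Import all_classical all_reals all_analysis.
From mathcomp Require Export complex.
Export Order.TTheory GRing.Theory Num.Theory ComplexField.
Export numFieldNormedType.Exports.

Set Implicit Arguments.
Unset Strict Implicit.
Unset Printing Implicit Defensive.

Local Open Scope ring_scope.
Local Open Scope classical_set_scope.
Local Open Scope complex_scope.

Section Defs.
Variables (R : realType) (X : topologicalType).

Definition supnorm_le (f : X -> R[i]) (c : R) : Prop :=
  0 <= c /\ forall x, `|f x| <= c%:C.

Definition uniform_algebra (A : set (X -> R[i])) : Prop :=
  (forall f, A f -> continuous (f : X -> R[i]^o)) /\
      (forall c : R[i], A (fun _ => c)) /\
      (forall f g, A f -> A g -> A (fun x => f x + g x)) /\
      (forall (l : R[i]) f, A f -> A (fun x => l * f x)) /\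
      (forall f g, A f -> A g -> A (fun x => f x * g x)) /\
      (forall f, continuous (f : X -> R[i]^o) ->
         (forall e : R, 0 < e -> exists g, (A g /\ supnorm_le (fun x => f x - g x) e)) ->
         A f).

Definition vnorm2 (n : nat) (v : 'cV[R[i]]_n) : R[i] := \sum_(i < n) `|v i 0| ^+ 2.

Definition opnorm_le (n : nat) (M : 'M[R[i]]_n) (c : R) : Prop :=
  0 <= c /\ forall v : 'cV[R[i]]_n, vnorm2 (M *m v) <= (c ^+ 2)%:C * vnorm2 v.

Definition mapnorm_le (A : set (X -> R[i])) (n : nat) (T : (X -> R[i]) -> 'M[R[i]]_n)
  (K : R) : Prop :=
  forall f, A f -> supnorm_le f 1 -> opnorm_le (T f) K.

Definition adjmx (n : nat) (M : 'M[R[i]]_n) : 'M[R[i]]_n := map_mx Num.conj M^T.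

Definition theta_alpha (n : nat) (theta : (X -> R[i]) -> 'M[R[i]]_n)
  (alpha : (X -> R[i]) -> (X -> R[i])) (f : X -> R[i]) : 'M[R[i]]_n :=
  (1 / 2 : R[i]) *: (theta f + adjmx (theta (alpha f))).

End Defs.

(* Main.v *)
(* Write theta_alpha(f) = (T + l I)/2 with T = theta(f), |l| <= 1, and let
   K = ||theta||, ||f|| <= 1.  From ||(T + l)v||^2 <= 4||v||^2 one gets
   2 Re<Tv, l v> <= 4||v||^2 - ||Tv||^2.  Applying theta to the disc automorphism
   (z + rl)/(1 + r l^* z) gives, to first order in r,
     ||Tv||^2 <= K^2 ||v||^2 + 2r(K^2 - 1) Re<Tv, l v> + O(r^2)||v||^2.
   Together they bound ||Tv||^2 / ||v||^2 by (K^2 + 4r(K^2 - 1) + O(r^2)) / (1 + r(K^2 - 1)),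
   which is below K^2 for small r if K > 2, uniformly in f and v: a contradiction.
   Since only first order in r matters, the automorphism may be replaced by the
   polynomial (z + rl)(1 - r l^* z), which avoids inverting 1 + r l^* f in A. *)
Require Import Defs.
From HB Require Import structures.
From mathcomp Require Import all_boot all_order all_algebra.
From mathcomp Require Import all_classical all_reals all_analysis.
From mathcomp Require Import complex.
From mathcomp Require Import ring lra.
Import Order.TTheory GRing.Theory Num.Theory ComplexField.
Import numFieldNormedType.Exports.
Local Open Scope ring_scope.
Local Open Scope classical_set_scope.
Local Open Scope complex_scope.

Set Implicit Arguments.
Unset Strict Implicit.

(** * Squared moduli in the real field, and the disc estimate *)

Definition sqn (R : rcfType) (z : R[i]) : R := complex.Re z ^+ 2 + complex.Im z ^+ 2.

Lemma sqn_ge0 (R : rcfType) (z : R[i]) : 0 <= sqn z.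
Proof. by rewrite /sqn addr_ge0 // sqr_ge0. Qed.

Lemma sqr_norm_sqn (R : rcfType) (z : R[i]) : `|z| ^+ 2 = (sqn z)%:C.
Proof. by rewrite normc_def -rmorphXn /= sqr_sqrtr // sqn_ge0. Qed.

Lemma sqnM (R : rcfType) (z w : R[i]) : sqn (z * w) = sqn z * sqn w.
Proof. by case: z => a b; case: w => c d; rewrite /sqn /=; ring. Qed.

Lemma sqnJ (R : rcfType) (z : R[i]) : sqn (Num.conj z) = sqn z.
Proof. by case: z => a b; rewrite /sqn /=; ring. Qed.

Lemma sqn_real (R : rcfType) (r : R) : sqn r%:C = r ^+ 2.
Proof. by rewrite /sqn /=; ring. Qed.

Lemma norm_le_sqn (R : rcfType) (z : R[i]) (c : R) :
  0 <= c -> (`|z| <= c%:C) = (sqn z <= c ^+ 2).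
Proof.
move=> c0; have c0' : 0 <= c%:C by rewrite ler0c.
by rewrite -lecR -sqr_norm_sqn rmorphXn /= ler_pXn2r ?nnegrE.
Qed.

(* With w = L^* z, the product is (z + L)/(1 + w) * (1 - w^2): a disc
   automorphism times a perturbation of modulus at most 1 + |L|^2. *)
Lemma moebius_le (R : rcfType) (z L : R[i]) (r : R) :
  r <= 1 -> 0 <= r -> sqn z <= 1 -> sqn L <= r ^+ 2 ->
  sqn ((z + L) * (1 - Num.conj L * z)) <= (1 + r ^+ 2) ^+ 2.
Proof.
move=> r1 r0 z1 L1; rewrite sqnM; set w := Num.conj L * z.
have wE : sqn w <= r ^+ 2.
  rewrite sqnM sqnJ -[leRHS]mulr1; apply: ler_pM => //; exact: sqn_ge0.
have L2 : sqn L <= 1 by apply: le_trans L1 _; rewrite expr_le1.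
(* Schwarz-Pick identity: [|1 + w|^2 - |z + L|^2 = (1 - |z|^2) (1 - |L|^2)]. *)
have le1 : sqn (z + L) <= sqn (1 + w).
  have := mulr_ge0 (eqbRL (subr_ge0 _ _) z1) (eqbRL (subr_ge0 _ _) L2).
  rewrite -(subr_ge0 (sqn (z + L))) /w.
  by case: (z) => a b; case: (L) => c d; rewrite /sqn /=; congr (0 <= _); ring.
apply: le_trans (ler_wpM2r (sqn_ge0 _) le1) _.
have := sqn_ge0 w; move: wE; rewrite -sqnM; case: (w) => a b; rewrite /sqn /=.
set t := r ^+ 2 => ht h0.
have a2 := sqr_ge0 a.
have -> : ((1 + a) * (1 - a) - (0 + b) * (0 - b)) ^+ 2 +
  ((1 + a) * (0 - b) + (0 + b) * (1 - a)) ^+ 2 =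
  (1 + (a ^+ 2 + b ^+ 2)) ^+ 2 - 4 * a ^+ 2 by ring.
have : (1 + (a ^+ 2 + b ^+ 2)) ^+ 2 <= (1 + t) ^+ 2.
  by rewrite ler_pXn2r ?nnegrE //; lra.
by lra.
Qed.

(** * Squared Euclidean norms and their expansions *)

Definition sqnorm (R : rcfType) (n : nat) (v : 'cV[R[i]]_n) : R :=
  \sum_(i < n) sqn (v i 0).

Lemma vnorm2E (R : realType) (n : nat) (v : 'cV[R[i]]_n) :
  vnorm2 v = (sqnorm v)%:C.
Proof.
by rewrite /vnorm2 /sqnorm rmorph_sum /=; apply: eq_bigr => i _; exact: sqr_norm_sqn.
Qed.

Lemma sqnorm_ge0 (R : rcfType) (n : nat) (v : 'cV[R[i]]_n) : 0 <= sqnorm v.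
Proof. by apply: sumr_ge0 => i _; exact: sqn_ge0. Qed.

Lemma sqnormZ (R : rcfType) (n : nat) (c : R[i]) (v : 'cV[R[i]]_n) :
  sqnorm (c *: v) = sqn c * sqnorm v.
Proof. by rewrite /sqnorm mulr_sumr; apply: eq_bigr => i _; rewrite mxE sqnM. Qed.

(** Young's inequality: the two sides differ by [t^-1 |t u - e|^2]. The weight [t] is free so that a
    small [e] can be absorbed at little cost to [u]. *)
Lemma sqnormD_le (R : rcfType) (n : nat) (t : R) (u e : 'cV[R[i]]_n) :
  0 < t -> sqnorm (u + e) <= (1 + t) * sqnorm u + (1 + t^-1) * sqnorm e.
Proof.
move=> t0; rewrite /sqnorm !mulr_sumr -big_split /=; apply: ler_sum => i _.
rewrite mxE; case: (u i 0) => a b; case: (e i 0) => c d; rewrite /sqn /= -subr_ge0.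
have -> : (1 + t) * (a ^+ 2 + b ^+ 2) + (1 + t^-1) * (c ^+ 2 + d ^+ 2) -
  ((a + c) ^+ 2 + (b + d) ^+ 2) = t^-1 * ((t * a - c) ^+ 2 + (t * b - d) ^+ 2).
  by field; rewrite gt_eqF.
by apply: mulr_ge0; [rewrite invr_ge0 ltW | rewrite addr_ge0 ?sqr_ge0].
Qed.

(** This is [2 Re<u, l v>], for the inner product linear in its first argument. *)
Definition cross (R : rcfType) (n : nat) (l : R[i]) (u v : 'cV[R[i]]_n) : R :=
  \sum_(i < n) 2 * complex.Re (Num.conj l * u i 0 * Num.conj (v i 0)).

Lemma sqnormDZ (R : rcfType) (n : nat) (l : R[i]) (u v : 'cV[R[i]]_n) :
  sqnorm (u + l *: v) = sqnorm u + cross l u v + sqn l * sqnorm v.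
Proof.
rewrite /sqnorm /cross mulr_sumr -!big_split /=; apply: eq_bigr => i _; rewrite !mxE.
by case: (u i 0) => a b; case: (v i 0) => c d; case: l => x y; rewrite /sqn /=; ring.
Qed.

Lemma cross_swap (R : rcfType) (n : nat) (l : R[i]) (u v : 'cV[R[i]]_n) :
  cross (Num.conj l) v u = cross l u v.
Proof.
apply: eq_bigr => i _.
by case: (u i 0) => a b; case: (v i 0) => c d; case: l => x y /=; ring.
Qed.

Lemma cross_scale (R : rcfType) (n : nat) (r : R) (l : R[i]) (u v : 'cV[R[i]]_n) :
  cross (r%:C * l) u v = r * cross l u v.
Proof.
rewrite /cross mulr_sumr; apply: eq_bigr => i _.
by case: (u i 0) => a b; case: (v i 0) => c d; case: l => x y /=; ring.
Qed.

(* The coefficient of the O(r^2) term, uniform in f and v. *)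
Definition improvement_const (R : rcfType) (q : R) : R :=
  q ^+ 2 + 14 * q * (1 + q) + 2 * ((2 * q + 2) * q ^+ 2).

(** Here [s = |Tv|^2], [V = |v|^2], [c = 2 Re<Tv, l v>] and [lam = |l|^2]. To first order the last
    hypothesis reads [s <= q V + r (q - 1) c]; adding [r (q - 1)] times [s + c <= 4 V] cancels
    [c]. *)
Lemma scalar_improvement (R : rcfType) (q r s V c lam : R) :
  1 <= q -> 0 <= r -> r <= 1 -> 0 <= lam -> lam <= 1 ->
  0 <= s -> 0 <= V -> s <= q * V -> s + c + lam * V <= 4 * V ->
  0 <= V + r * c + r ^+ 2 * lam * s ->
  V + r * c + r ^+ 2 * lam * s <= 2 * (1 + q) * V ->
  s + r * c + r ^+ 2 * lam * V <=
    (1 + r ^+ 2) * (q * (1 + r ^+ 2) ^+ 2 * (V + r * c + r ^+ 2 * lam * s))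
    + (1 + r ^+ 2) * r ^+ 2 * ((2 * q + 2) * q ^+ 2 * V) ->
  (1 + r * (q - 1)) * s <=
    (q + 4 * r * (q - 1) + improvement_const q * r ^+ 2) * V.
Proof.
move=> q1 r0 r1 lam0 lam1 s0 V0 sq H1 N0 N2 H.
set t := r ^+ 2 in N0 N2 H *.
have t0 : 0 <= t by rewrite sqr_ge0.
have t1 : t <= 1 by rewrite expr_le1.
have tl0 : 0 <= t * lam by rewrite mulr_ge0.
have tlt : t * lam <= t by rewrite ler_piMr.
set N := V + r * c + t * lam * s in N0 N2 H.
have q0 : 0 <= q by lra.
(* The difference of the two sides is [t (4 + t) (1 - t)]. *)
have cube : (1 + t) * (1 + t) ^+ 2 <= 1 + 7 * t.
  have : 0 <= t * (4 + t) * (1 - t) by rewrite !mulr_ge0 //; lra.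
  by lra.
have h1 : (1 + t) * (q * (1 + t) ^+ 2 * N) <= q * N + 14 * q * (1 + q) * t * V.
  have := ler_wpM2r (mulr_ge0 q0 N0) cube.
  have := ler_wpM2l (mulr_ge0 q0 t0) N2.
  by lra.
have h2 : (1 + t) * t * ((2 * q + 2) * q ^+ 2 * V) <=
    2 * ((2 * q + 2) * q ^+ 2) * t * V.
  have D0 : 0 <= t * ((2 * q + 2) * q ^+ 2 * V).
    by rewrite !mulr_ge0 ?sqr_ge0 //; lra.
  have := mulr_ge0 (eqbRL (subr_ge0 _ _) t1) D0.
  by lra.
have h3 : q * N <= q * (V + r * c) + q ^+ 2 * t * V.
  have : t * lam * s <= t * (q * V) by apply: ler_pM.
  by move/(ler_wpM2l q0); rewrite /N; lra.
have h4 : r * (q - 1) * (s + c) <= r * (q - 1) * (4 * V).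
  apply: ler_wpM2l; first by rewrite mulr_ge0 //; lra.
  by have := mulr_ge0 lam0 V0; lra.
have h5 : 0 <= t * lam * V by rewrite mulr_ge0.
(* The errors in [h1], [h2] and [h3] are the three summands of the constant, times [t V]; [h4]
   eliminates [c], and [h5] discards the term in [lam] on the left. *)
rewrite /improvement_const -/t; lra.
Qed.

(** The bound on the polynomial in [T] is tested at [y = (1 + conj L T) v], which [1 - conj L T]
    sends to [v] up to second order in [r]. This turns it into a bound on [(T + L) v] without
    inverting a matrix. *)
Lemma vector_improvement (R : rcfType) (n : nat) (T : 'M[R[i]]_n) (l : R[i])
    (q r : R) (v : 'cV[R[i]]_n) :
  let L := r%:C * l in
  1 <= q -> 0 < r -> r <= 1 -> sqn l <= 1 ->
  (forall w : 'cV_n, sqnorm (T *m w) <= q * sqnorm w) ->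
  (forall w : 'cV_n, sqnorm ((T + L%:M) *m (1%:M - Num.conj L *: T) *m w) <=
     q * (1 + r ^+ 2) ^+ 2 * sqnorm w) ->
  sqnorm ((T + l%:M) *m v) <= 4 * sqnorm v ->
  (1 + r * (q - 1)) * sqnorm (T *m v) <=
    (q + 4 * r * (q - 1) + improvement_const q * r ^+ 2) * sqnorm v.
Proof.
move=> L q1 r0 r1 l1 Tq Tg Tl.
have q0 : 0 <= q by lra.
have sL : sqn L = r ^+ 2 * sqn l by rewrite sqnM sqn_real.
have r2 : r ^+ 2 <= 1 by rewrite expr_le1 // ltW.
have sL2 : sqn L <= r ^+ 2 by rewrite sL ler_piMr ?sqr_ge0.
have sL1 : sqn L <= 1 by apply: le_trans sL2 r2.
pose y := v + Num.conj L *: (T *m v).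
pose w := T *m (T *m v).
pose e := (Num.conj L ^+ 2) *: ((T + L%:M) *m w).
have mulDs (a : R[i]) (x : 'cV_n) : (T + a%:M) *m x = T *m x + a *: x.
  by rewrite mulmxDl mul_scalar_mx.
(* [(1 - conj L T) (1 + conj L T) = 1 - (conj L)^2 T^2], and [e] collects the remainder. *)
have gy : (T + L%:M) *m (1%:M - Num.conj L *: T) *m y = (T + L%:M) *m v - e.
  rewrite -mulmxA /e scalemxAr -mulmxBr; congr (_ *m _).
  rewrite mulmxBl mul1mx -scalemxAl /y mulmxDr -scalemxAr scalerDr scalerA -expr2.
  by rewrite opprD addrA addrK.
have eV : sqnorm e <= (r ^+ 2) ^+ 2 * ((2 * q + 2) * q ^+ 2 * sqnorm v).
  rewrite sqnormZ expr2 sqnM sqnJ -expr2.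
  apply: ler_pM; rewrite ?sqr_ge0 ?sqnorm_ge0 //.
    by rewrite ler_pXn2r // nnegrE ?sqn_ge0 ?sqr_ge0.
  have wV : sqnorm w <= q ^+ 2 * sqnorm v.
    by apply: le_trans (Tq _) _; rewrite expr2 -mulrA ler_wpM2l.
  have TLw : sqnorm ((T + L%:M) *m w) <= (2 * q + 2) * sqnorm w.
    rewrite mulDs; apply: le_trans (sqnormD_le (T *m w) (L *: w) ltr01) _.
    rewrite invr1 sqnormZ; have := Tq w.
    by have := ler_wpM2r (sqnorm_ge0 w) sL1; lra.
  apply: le_trans TLw _; rewrite -mulrA; apply: ler_wpM2l => //; lra.
have yE : sqnorm y = sqnorm v + r * cross l (T *m v) v + r ^+ 2 * sqn l * sqnorm (T *m v).
  by rewrite sqnormDZ cross_swap cross_scale sqnJ sL.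
apply: (@scalar_improvement _ _ _ _ _ (cross l (T *m v) v) (sqn l)) => //;
  rewrite ?sqn_ge0 ?sqnorm_ge0 //.
- exact: ltW.
- by rewrite -sqnormDZ -mulDs.
- by rewrite -yE sqnorm_ge0.
- rewrite -yE; apply: le_trans (sqnormD_le v _ ltr01) _.
  rewrite invr1 sqnormZ sqnJ; have := Tq v.
  by have := ler_wpM2r (sqnorm_ge0 (T *m v)) sL1; lra.
- rewrite -yE -cross_scale -sL -sqnormDZ -mulDs -[X in sqnorm X](subrK e) -gy.
  have t0 : 0 < r ^+ 2 by rewrite exprn_gt0.
  (* With weight [r^2], the factor [1 + r^-2] on [|e|^2 = O(r^4)] still leaves [O(r^2)]. *)
  apply: le_trans (sqnormD_le _ _ t0) _; apply: lerD.
    by apply: ler_wpM2l; [lra | exact: Tg].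
  have -> : (1 + r ^+ 2) * r ^+ 2 * ((2 * q + 2) * q ^+ 2 * sqnorm v) =
    (1 + (r ^+ 2)^-1) * ((r ^+ 2) ^+ 2 * ((2 * q + 2) * q ^+ 2 * sqnorm v)).
    by field; rewrite gt_eqF.
  by apply: ler_wpM2l => //; rewrite addr_ge0 ?invr_ge0 ?sqr_ge0.
Qed.

(** The quotient of the two coefficients is below [q] exactly when [C r < (q - 4) (q - 1)]. Both [r]
    and [q'] precede [s] and [V], which makes the gain uniform. *)
Lemma strict_improvement (R : rcfType) (q : R) : 4 < q ->
  exists r q' : R, [/\ 0 < r, r <= 1, 0 <= q', q' < q &
    forall s V : R, 0 <= V -> (1 + r * (q - 1)) * s <=
      (q + 4 * r * (q - 1) + improvement_const q * r ^+ 2) * V -> s <= q' * V].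
Proof.
move=> q4; set C := improvement_const q.
have q3 : 0 < q ^+ 3 by rewrite exprn_gt0; lra.
have C1 : (q - 4) * (q - 1) < C by rewrite /C /improvement_const; nra.
have e0 : 0 < (q - 4) * (q - 1) by rewrite mulr_gt0; lra.
have C0 : 0 < C by lra.
(* Half the critical value of [r]; [C1] keeps it below 1. *)
pose r := (q - 4) * (q - 1) / (2 * C).
have r0 : 0 < r by rewrite divr_gt0 // mulr_gt0.
have rC : C * r = (q - 4) * (q - 1) / 2 by rewrite /r; field; rewrite gt_eqF.
have d0 : 0 < 1 + r * (q - 1) by rewrite addr_gt0 // mulr_gt0 //; lra.
exists r, ((q + 4 * r * (q - 1) + C * r ^+ 2) / (1 + r * (q - 1))); split=> //.
- by rewrite ler_pdivrMr ?mul1r ?mulr_gt0 //; lra.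
- have h1 : 0 <= r * (q - 1) by rewrite mulr_ge0 //; lra.
  have h2 : 0 <= C * r ^+ 2 by rewrite mulr_ge0 ?sqr_ge0 // ltW.
  by apply: divr_ge0; lra.
- rewrite ltr_pdivrMr // expr2 mulrA rC.
  have := mulr_gt0 r0 e0; lra.
- by move=> s V V0; rewrite [_ / _ * V]mulrAC ler_pdivlMr // [s * _]mulrC.
Qed.

(** * Bounds [q] on the square of [||theta||], and their improvement *)

Definition sqbound (R : realType) (X : topologicalType) (A : set (X -> R[i])) (n : nat)
    (theta : (X -> R[i]) -> 'M[R[i]]_n) (q : R) : Prop :=
  0 <= q /\ forall f, A f -> supnorm_le f 1 ->
    forall v : 'cV[R[i]]_n, sqnorm (theta f *m v) <= q * sqnorm v.

Lemma opnorm_leE (R : realType) (n : nat) (M : 'M[R[i]]_n) (c : R) :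
  opnorm_le M c <->
  0 <= c /\ forall v : 'cV[R[i]]_n, sqnorm (M *m v) <= c ^+ 2 * sqnorm v.
Proof.
by split=> -[c0 H]; split=> // v; have := H v; rewrite !vnorm2E -rmorphM /= lecR.
Qed.

Section Homomorphism.
Variables (R : realType) (X : topologicalType) (A : set (X -> R[i])) (n : nat).
Variable theta : (X -> R[i]) -> 'M[R[i]]_n.
Hypothesis Aalg : uniform_algebra A.
Hypothesis thetaD : forall (l : R[i]) f g, A f -> A g ->
  theta (fun x => l * f x + g x) = l *: theta f + theta g.
Hypothesis thetaM : forall f g, A f -> A g ->
  theta (fun x => f x * g x) = theta f *m theta g.
Hypothesis theta1 : theta (fun _ => 1) = 1%:M.

Lemma alg_const (c : R[i]) : A (fun _ => c).
Proof. by case: Aalg => _ []. Qed.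

Lemma alg_affine (l c : R[i]) f : A f -> A (fun x => l * f x + c).
Proof.
by case: Aalg => _ [Ac [AD [AZ _]]] Af; apply: (AD (fun x => l * f x)); [exact: AZ | exact: Ac].
Qed.

Lemma alg_mul f g : A f -> A g -> A (fun x => f x * g x).
Proof. by case: Aalg => _ [_ [_ [_ [AM _]]]]; exact: AM. Qed.

Lemma hom_const (c : R[i]) : theta (fun _ => c) = c%:M.
Proof.
(* Linearity comes only in the form [l f + g]; taking [f = g = 1] avoids computing [theta] at 0
   first. *)
have -> : (fun _ : X => c) = (fun _ => (c - 1) * 1 + 1).
  by apply/funext => x; rewrite mulr1 subrK.
rewrite (thetaD _ (alg_const 1) (alg_const 1)) theta1.
by rewrite scalemx1 -raddfD /= subrK.
Qed.

Lemma hom_affine (l c : R[i]) f : A f ->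
  theta (fun x => l * f x + c) = l *: theta f + c%:M.
Proof. by move=> Af; rewrite (thetaD _ Af (alg_const c)) hom_const. Qed.

Lemma sqbound_scale (q c : R) f (v : 'cV[R[i]]_n) : sqbound A theta q ->
  0 < c -> A f -> supnorm_le f c -> sqnorm (theta f *m v) <= q * c ^+ 2 * sqnorm v.
Proof.
move=> [q0 H] c0 Af [_ fc].
have Ag := alg_affine c^-1%:C 0 Af.
have gE := hom_affine c^-1%:C 0 Af.
have g1 : supnorm_le (fun x => c^-1%:C * f x + 0) 1.
  split=> // x; rewrite addr0 norm_le_sqn // sqnM sqn_real exprVn.
  have := fc x; rewrite norm_le_sqn ?(ltW c0) // expr1n => fx.
  by rewrite mulrC ler_pdivrMr ?mul1r // exprn_gt0.
have := H _ Ag g1 v; rewrite gE raddf0 addr0 -scalemxAl sqnormZ sqn_real exprVn.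
by rewrite mulrC ler_pdivrMr ?exprn_gt0 // mulrAC.
Qed.

(** The polynomial [(f + L) (1 - conj L f)] stays in [A] and has sup norm at most [1 + r^2], so
    rescaling the bound [q] controls its image under [theta]. *)
Lemma sqbound_improve (q : R) : 4 < q -> sqbound A theta q ->
  (forall f, A f -> supnorm_le f 1 -> exists2 l : R[i], sqn l <= 1 &
     forall v : 'cV[R[i]]_n, sqnorm ((theta f + l%:M) *m v) <= 4 * sqnorm v) ->
  exists2 q' : R, q' < q & sqbound A theta q'.
Proof.
move=> q4 bq H; have [r [q' [r0 r1 q'0 q'q step]]] := strict_improvement q4.
exists q' => //; split=> // f Af f1 v; apply: step (sqnorm_ge0 v) _.
have [l l1 Hl] := H f Af f1.
apply: (vector_improvement _ r0 r1 l1) => //; first lra.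
  by case: bq => _ + w => /(_ f Af f1 w).
move=> w; set L := r%:C * l; set b := Num.conj L.
have L1 : sqn L <= r ^+ 2 by rewrite sqnM sqn_real ler_piMr ?sqr_ge0.
have -> : (theta f + L%:M) *m (1%:M - b *: theta f) =
    theta (fun x => (1 * f x + L) * (- b * f x + 1)).
  rewrite (thetaM (alg_affine 1 L Af) (alg_affine (- b) 1 Af)) !hom_affine //.
  by rewrite scale1r scaleNr [X in _ *m X]addrC.
apply: sqbound_scale bq _ (alg_mul (alg_affine _ _ Af) (alg_affine _ _ Af)) _.
  by rewrite addr_gt0 // exprn_gt0.
have c0 : 0 <= 1 + r ^+ 2 by rewrite addr_ge0 // sqr_ge0.
split=> // x; rewrite norm_le_sqn // mul1r mulNr [- _ + 1]addrC.
apply: moebius_le => //; first exact: ltW.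
by have := (f1.2 x); rewrite norm_le_sqn // expr1n.
Qed.

End Homomorphism.

Lemma contraction_const (R : realType) (X : topologicalType) (A : set (X -> R[i]))
    (alpha : (X -> R[i]) -> (X -> R[i])) f :
  (forall f c, A f -> supnorm_le f c -> supnorm_le (alpha f) c) ->
  (forall f, A f -> exists l : R[i], alpha f = (fun _ => l)) ->
  A f -> supnorm_le f 1 -> exists2 l : R[i], sqn l <= 1 & alpha f = (fun _ => l).
Proof.
move=> contr const Af f1.
case: (pselect (exists x : X, True)) => [[x _]|noX].
  have [l al] := const f Af; exists l => //.
  have [_ /(_ x)] := contr f 1 Af f1.
  by rewrite al norm_le_sqn // expr1n.
(* On an empty [X] the contraction bound says nothing about [l], but all functions coincide, so 0
   serves. *)
exists 0; first by rewrite sqn_real expr0n.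
by apply/funext => x; case: noX; exists x.
Qed.

Unset Implicit Arguments.

Theorem theorem1p4 (R : realType) (X : topologicalType)
  (A : set (X -> R[i])) (n : nat)
  (theta : (X -> R[i]) -> 'M[R[i]]_n)
  (alpha : (X -> R[i]) -> (X -> R[i])) :
  compact [set: X] -> hausdorff_space X ->
  uniform_algebra A ->
  (* theta : A -> M_n(C) is a continuous unital homomorphism *)
  (forall (l : R[i]) f g, A f -> A g ->
     theta (fun x => l * f x + g x) = l *: theta f + theta g) ->
  (forall f g, A f -> A g -> theta (fun x => f x * g x) = theta f *m theta g) ->
  theta (fun _ => 1) = 1%:M ->
  (exists K : R, mapnorm_le A theta K) ->
  (* alpha : A -> A is a unital antilinear contraction with alpha(A) in C1 *)
  (forall f, A f -> A (alpha f)) ->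
  (forall (l : R[i]) f g, A f -> A g ->
     alpha (fun x => l * f x + g x) = (fun x => Num.conj l * alpha f x + alpha g x)) ->
  alpha (fun _ => 1) = (fun _ => 1) ->
  (forall f c, A f -> supnorm_le f c -> supnorm_le (alpha f) c) ->
  (forall f, A f -> exists l : R[i], alpha f = (fun _ => l)) ->
  mapnorm_le A (theta_alpha theta alpha) 1 ->
  mapnorm_le A theta 2.
Proof.
move=> _ _ Aalg thetaD thetaM theta1 [K HK] _ _ _ contr const Halpha.
have H f : A f -> supnorm_le f 1 -> exists2 l : R[i], sqn l <= 1 &
    forall v : 'cV[R[i]]_n, sqnorm ((theta f + l%:M) *m v) <= 4 * sqnorm v.
  move=> Af f1; have [l l1 al] := contraction_const contr const Af f1.
  (* The adjoint of [theta (alpha f) = l I] is [conj l I]. *)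
  exists (Num.conj l); first by rewrite sqnJ.
  move=> v; have /opnorm_leE[_ /(_ v)] := Halpha f Af f1.
  rewrite /theta_alpha al (hom_const Aalg thetaD theta1) /adjmx tr_scalar_mx.
  rewrite map_scalar_mx /= -scalemxAl sqnormZ expr1n mul1r.
  rewrite (_ : sqn _ = 4^-1); last first.
    rewrite (_ : _^-1 = (2^-1)%:C :> R[i]); last by rewrite fmorphV rmorph_nat.
    by rewrite sqn_real; field.
  by lra.
(* Continuity makes [S] nonempty. Its infimum belongs to [S], so an infimum above 4 could be
   improved, contradicting minimality. *)
pose S := [set q | sqbound A theta q].
have S0 : S !=set0.
  exists (K ^+ 2); split=> [|f Af f1 v]; first exact: sqr_ge0.
  by have /opnorm_leE[_ ->] := HK f Af f1.
have Slb : has_lbound S by exists 0 => q [].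
have Sinf : S (inf S).
  split=> [|f Af f1 v]; first by apply: lb_le_inf => // q [].
  (* If [|v| = 0], any member of [S] gives the bound; otherwise dividing by [|v|^2] exhibits a lower
     bound of [S]. *)
  have [V0|V0] := eqVneq (sqnorm v) 0.
    by have [q [_ /(_ f Af f1 v)]] := S0; rewrite V0 !mulr0.
  have V1 : 0 < sqnorm v by rewrite lt_def V0 sqnorm_ge0.
  rewrite -ler_pdivrMr //; apply: lb_le_inf => // q [_ Hq].
  by rewrite ler_pdivrMr // Hq.
have inf4 : inf S <= 4.
  rewrite leNgt; apply/negP => inf4.
  have [q' q'lt Sq'] := sqbound_improve Aalg thetaD thetaM theta1 inf4 Sinf H.
  by have := ge_inf Slb Sq'; rewrite leNgt q'lt.
move=> f Af f1; apply/opnorm_leE; split=> // v.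
have [_ /(_ f Af f1 v) Hv] := Sinf; apply: le_trans Hv _.
have -> : (2 : R) ^+ 2 = 4 by ring.
by rewrite ler_wpM2r ?sqnorm_ge0.
Qed.
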